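(* Consider the distribution on $\mathbb S^1\times\mathbb R^2$ with coordinates $(\theta,x,y)$ generated by $X_1=\partial_\theta$ and $X_2=\cos\theta\,\partial_x+\sin\theta\,\partial_y$ (the rolling disc). The nilpotent approximation at the origin $(0,0,0)$ (in the coordinates $(\theta,x,y)$) is given by the distribution generated by $$n_1=\partial_\theta,\qquad n_2=\partial_x+\theta\,\partial_y,$$ with the only non-trivial bracket $[n_1,n_2]=n_3:=\partial_y$. Thus the symbol is the Lie algebra $\mathfrak m=\langle n_1,n_2,n_3\rangle$ with $[n_1,n_2]=n_3$, which is a graded nilpotent Lie algebra $\mathfrak m=\mathfrak g^{-2}\oplus\mathfrak g^{-1}$, where $\mathfrak g^{-2}=\langle n_3\rangle$ and $\mathfrak g^{-1}=\langle n_1,n_2\rangle$.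
   Context: For a distribution generated by $X_1,X_2$ with growth vector $(2,3)$ at a point $p$, the nonholonomic order at $p$ of a smooth function $f$ is the least $s$ such that some iterated derivative $X_{i_1}\cdots X_{i_s}f$ ($i_j\in\{1,2\}$) does not vanish at $p$. Local coordinates $(z_1,z_2,z_3)$ centred at $p$ are privileged with weights $(1,1,2)$ if $z_1,z_2,z_3$ have nonholonomic order $1,1,2$ at $p$, respectively, and $dz_1,dz_2$ restrict to independent forms on the distribution at $p$. Assign weight $w_i$ to $z_i$ and weight $-w_i$ to $\partial_{z_i}$, where $(w_1,w_2,w_3)=(1,1,2)$. The (homogeneous) nilpotent approximation at $p$ of the family $X_1,X_2$ is the pair of vector fields obtained by expanding the coefficients of $X_1,X_2$ in Taylor series at $p$ in privileged coordinates and keeping exactly the part of weighted degree $-1$. The symbol is the graded Lie algebra generated by these approximating vector fields (the nonholonomic tangent algebra at $p$). *)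

(* Defs.v *)
From HB Require Import structures.
From mathcomp Require Import all_boot all_order all_algebra.
From mathcomp Require Import all_classical all_reals all_analysis.

Set Implicit Arguments.
Unset Strict Implicit.
Unset Printing Implicit Defensive.

Import Order.TTheory GRing.Theory Num.Theory.
Import numFieldNormedType.Exports.

Local Open Scope classical_set_scope.
Local Open Scope ring_scope.

(* Lie algebras are given by a set [m] in an ambient module with an operation
   [br] that need only satisfy the axioms on [m]. *)
Section LieAlgebra.
Context {R : pzRingType} {V : lmodType R}.
Variable br : V -> V -> V.
Implicit Types (m A B S : set V) (g : int -> set V).

Definition lsubspace A : Prop := submod_closed [in A].

Definition lspan S : set V := smallest lsubspace S.

Definition lin_indep (s : seq V) : Prop :=
  forall c : 'I_(size s) -> R,
    \sum_(i < size s) c i *: s`_i = 0 -> forall i, c i = 0.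

Definition direct_sum m A B : Prop :=
  A `&` B = [set 0] /\ m = [set a + b | a in A & b in B].

Definition lie_closed m : Prop :=
  lsubspace m /\ forall x y, m x -> m y -> m (br x y).

Definition lie_generated S : set V := smallest lie_closed S.

Definition lie_algebra m : Prop :=
  [/\ lie_closed m,
      forall a x y z, m x -> m y -> m z ->
        br (a *: x + y) z = a *: br x z + br y z,
      forall a x y z, m x -> m y -> m z ->
        br z (a *: x + y) = a *: br z x + br z y,
      forall x, m x -> br x x = 0 &
      forall x y z, m x -> m y -> m z ->
        br x (br y z) + br y (br z x) + br z (br x y) = 0].

Fixpoint lower_central m (s : nat) : set V :=
  if s is s'.+1 then lspan [set br x y | x in m & y in lower_central m s']
  else m.

Definition lie_nilpotent m : Prop := exists s, lower_central m s = [set 0].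

Definition lie_grading m g : Prop :=
  [/\ forall k, lsubspace (g k),
      forall k, g k `<=` m,
      forall x, m x -> exists! y : int -> V,
        [/\ forall k, g k (y k), finite_set [set k | y k != 0]
          & x = \sum_(k \in [set: int]) y k] &
      forall j k x y, g j x -> g k y -> g (j + k) (br x y)].

End LieAlgebra.

Section Calculus.
Context {R : realType} {n : nat}.
Notation vec := 'rV[R]_n.
Notation vfield := (vec -> vec).

Definition pder {W : normedModType R} (i : 'I_n) (f : vec -> W) : vec -> W :=
  fun q => 'D_(delta_mx 0 i) f q.

(* C^oo near p: on one neighbourhood of p, all iterated partial derivatives
   exist and are differentiable *)
Definition smooth_near {W : normedModType R} (p : vec) (f : vec -> W) : Prop :=
  \forall q \near p, forall s : seq 'I_n, differentiable (foldr pder f s) q.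

Definition lieD (X : vfield) (f : vec -> R) : vec -> R :=
  fun q => 'D_(X q) f q.

Definition bracket (X Y : vfield) : vfield :=
  fun q => 'D_(X q) Y q - 'D_(Y q) X q.

(* The value at p of the iterated brackets of length <= s, spanning
   D^s(p), where D^1 = D and D^(s+1) = D^s + [D, D^s]. *)
Fixpoint brackets (X : 'I_2 -> vfield) (s : nat) : seq vfield :=
  match s with
  | 0%N => [::]
  | 1%N => codom X
  | s'.+1 => brackets X s' ++
             [seq bracket (X i) Y | i <- enum 'I_2, Y <- brackets X s']
  end.

Definition flag (X : 'I_2 -> vfield) (p : vec) (s : nat) : {vspace vec} :=
  <<[seq Y p | Y <- brackets X s]>>%VS.

Definition growth_vector (X : 'I_2 -> vfield) (p : vec) (gv : seq nat) : Prop :=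
  [/\ gv != [::],
      forall s, (s < size gv)%N -> \dim (flag X p s.+1) = gv`_s :> nat &
      flag X p (size gv) = fullv].

(* foldr applies the derivations of the word [:: i_1; ...; i_s] as
   X_{i_1} (... (X_{i_s} f)). *)
Definition iter_lieD (X : 'I_2 -> vfield) (u : seq 'I_2) (f : vec -> R) :=
  foldr (fun i => lieD (X i)) f u.

Definition nonholonomic_order (X : 'I_2 -> vfield) (p : vec) (f : vec -> R)
    (s : nat) : Prop :=
  (exists2 u, size u = s & iter_lieD X u f p != 0) /\
  (forall u, (size u < s)%N -> iter_lieD X u f p = 0).

Definition coordf (z : vec -> vec) (i : 'I_n) : vec -> R := fun q => z q 0 i.

(* z is a system of local coordinates centred at p; psi is its local inverse *)
Definition local_coords (p : vec) (z psi : vec -> vec) : Prop :=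
  [/\ z p = 0, psi 0 = p, smooth_near p z, smooth_near 0 psi &
      (\forall q \near p, psi (z q) = q) /\
      (\forall v \near (0 : vec), z (psi v) = v)].

(* the vector field X written in the coordinates z *)
Definition in_coords (z psi : vec -> vec) (X : vfield) : vfield :=
  fun v => 'd z (psi v) (X (psi v)).

Definition mder (al : 'I_n -> nat) (f : vec -> R) : vec -> R :=
  foldr (fun i => iter (al i) (pder i)) f (enum 'I_n).

(* The part of weighted degree d of the Taylor series of f at 0, for positive
   weights w: since w_i >= 1, a multi-index of weighted degree d has all its
   entries <= d. *)
Definition weighted_part (w : 'I_n -> nat) (d : nat) (f : vec -> R) : vec -> R :=
  fun v =>
    \sum_(al : {ffun 'I_n -> 'I_d.+1} | (\sum_i w i * al i == d)%N)
      mder (fun i => al i) f 0 / (\prod_i (al i)`!)%N%:R * \prod_i v 0 i ^+ al i.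

(* z^al d/dz_i has weighted degree w.al - w_i, so the part of weighted degree k
   of a vector field has as i-th coefficient the part of weighted degree
   w_i + k of its i-th coefficient. *)
Definition vfield_part (w : 'I_n -> nat) (k : int) (X : vfield) : vfield :=
  fun v => \row_i (if (w i)%:Z + k is Posz d
                   then weighted_part w d (coordf X i) v else 0).

End Calculus.

Section NilpotentApproximation.
Context {R : realType}.
Notation vec := 'rV[R]_3.
Notation vfield := (vec -> vec).

Definition wt : 'I_3 -> nat := fun i => nth 0%N [:: 1; 1; 2]%N i.

Definition privileged (X : 'I_2 -> vfield) (p : vec) (z psi : vec -> vec) :
    Prop :=
  [/\ local_coords p z psi,
      forall i, nonholonomic_order X p (coordf z i) (wt i) &
      forall a b : R,
        (forall v, v \in flag X p 1 ->
           a * 'd (coordf z 0) p v + b * 'd (coordf z 1) p v = 0) ->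
        a = 0 /\ b = 0].

Definition nilpotent_approx (z psi : vec -> vec) (X : 'I_2 -> vfield) :
    'I_2 -> vfield :=
  fun i => vfield_part wt (-1) (in_coords z psi (X i)).

Definition symbol (z psi : vec -> vec) (X : 'I_2 -> vfield) : set vfield :=
  lie_generated bracket (range (nilpotent_approx z psi X)).

(* An element of weighted degree k is one that equals its own part of weighted
   degree k. *)
Definition symbol_grade (z psi : vec -> vec) (X : 'I_2 -> vfield) (k : int) :
    set vfield :=
  [set Y | symbol z psi X Y /\ Y = vfield_part wt k Y].

End NilpotentApproximation.

Section RollingDisc.
Variable R : realType.
Notation vec := 'rV[R]_3.
Notation vfield := (vec -> vec).

(* Points q = (theta, x, y) of the universal cover of S^1 x R^2. *)
Definition theta (q : vec) : R := q 0 0.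

Definition d_theta : vec := delta_mx 0 0.
Definition d_x : vec := delta_mx 0 1.
Definition d_y : vec := delta_mx 0 2%:R.

(* Vector fields on S^1 x R^2 = R^3 / (2 pi Z x 0 x 0) are the smooth fields on
   R^3 that are invariant under the deck transformations. *)
Definition vfield_S1xR2 (X : vfield) : Prop :=
  (forall p, smooth_near p X) /\
  (forall q, X (q + (2 * pi) *: d_theta) = X q).

Definition disc1 : vfield := fun _ => d_theta.
Definition disc2 : vfield :=
  fun q => cos (theta q) *: d_x + sin (theta q) *: d_y.
Definition disc : 'I_2 -> vfield := fun i => [:: disc1; disc2]`_i.

Definition n1 : vfield := fun _ => d_theta.
Definition n2 : vfield := fun q => d_x + theta q *: d_y.
Definition n3 : vfield := fun _ => d_y.

End RollingDisc.

Arguments disc R _ : clear implicits.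
Arguments n1 R _ : clear implicits.
Arguments n2 R _ : clear implicits.
Arguments n3 R _ : clear implicits.

(* Main.v *)
From HB Require Import structures.
Require Import Defs.
From mathcomp Require Import all_boot all_order all_algebra.
From mathcomp Require Import all_classical all_reals all_analysis.
From mathcomp Require Import ring zify.
Import Order.TTheory GRing.Theory Num.Theory.
Import numFieldNormedType.Exports.
Local Open Scope classical_set_scope.
Local Open Scope ring_scope.

Set Implicit Arguments.
Unset Strict Implicit.

(** Every vector field in sight depends on [theta] alone, and only through
    [cos theta], [sin theta] and [theta]. The fields of the form
    [trig_affine u v a b] are closed under partial derivatives, and their
    derivative along [h] is [theta h] times the derivative in [theta]
    ([derive_trig_affine]). This one formula yields the smoothness of the
    distribution, the bracket of its two generators at the origin, and the
    nonholonomic orders of the coordinates: [y] has order 2 because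
    [X_2 y = sin theta] vanishes at the origin while [X_1 X_2 y = cos theta]
    does not.

    The nilpotent approximation is computed in the same way. As [theta] has
    weight 1, the part of weighted degree [d] of a function of [theta] is its
    usual Taylor term of degree [d] ([weighted_part_trig_affine]). Degree 0 is
    kept in the coefficients of [d/dtheta] and [d/dx] and degree 1 in that of
    [d/dy], so that [cos theta d/dx + sin theta d/dy] becomes
    [d/dx + theta d/dy].

    The algebraic claims concern the Heisenberg algebra of the fields
    [heis a b c = a n1 + b n2 + c n3]. Two formulas carry them:
    [bracket_heis], by which a bracket is [a b' - a' b] times [n3], and
    [vfield_part_heis], by which the part of degree -1 keeps [a] and [b], the
    part of degree -2 keeps [c], and all other parts vanish. The symbol is the
    set of all these fields ([symbolE]): they form a Lie algebra containing the
    generators [n1] and [n2], and [n3] is the bracket of these two. *)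

(** * Linear spans *)

Section Span.
Context {R : pzRingType} {V : lmodType R}.
Implicit Types (S A : set V) (x y : V).

Lemma lsubspaceP A :
  lsubspace A <-> A 0 /\ forall (a : R) x y, A x -> A y -> A (a *: x + y).
Proof.
split=> -[A0 AD]; split; rewrite ?inE // in A0 *.
  by move=> a x y Ax Ay; have := AD a x y; rewrite !inE; exact.
by move=> a x y; rewrite !inE; exact: AD.
Qed.

Lemma lspan_lsubspace S : lsubspace (lspan S).
Proof.
apply/lsubspaceP; split=> [A [/lsubspaceP[]] //|a x y Sx Sy A AS].
by have /lsubspaceP[_ AD] := AS.1; apply: AD; [exact: Sx|exact: Sy].
Qed.

Lemma lsubspaceZ A x (a : R) : lsubspace A -> A x -> A (a *: x).
Proof. by case/lsubspaceP=> A0 AD Ax; rewrite -[_ *: _]addr0; exact: AD. Qed.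

Lemma lsubspaceD A x y : lsubspace A -> A x -> A y -> A (x + y).
Proof.
by case/lsubspaceP=> A0 AD Ax Ay; rewrite -[x]scale1r; exact: AD.
Qed.

Lemma lspan_set1 x : lspan [set x] = [set a *: x | a in [set: R]].
Proof.
apply/seteqP; split; last first.
  move=> _ [a _ <-]; apply: (lsubspaceZ _ (lspan_lsubspace _)).
  exact: sub_gen_smallest.
apply: smallest_sub => [|_ ->]; last by exists 1; rewrite ?scale1r.
apply/lsubspaceP; split; first by exists 0; rewrite ?scale0r.
by move=> a _ _ [b _ <-] [c _ <-]; exists (a * b + c);
  rewrite // scalerDl scalerA.
Qed.

Lemma lspan_setU1 S x :
  lspan (S `|` [set x]) = [set s + a *: x | s in lspan S & a in [set: R]].
Proof.
have subS : lspan S `<=` lspan (S `|` [set x]).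
  by apply: sub_smallest2r; [exact: lspan_lsubspace|exact: subsetUl].
apply/seteqP; split; last first.
  move=> _ [s Ss [a _ <-]]; apply: (lsubspaceD (lspan_lsubspace _)).
    exact: subS.
  by apply: (lsubspaceZ _ (lspan_lsubspace _)); apply: sub_gen_smallest; right.
have /lsubspaceP[S0 SD] := lspan_lsubspace S.
apply: smallest_sub => [|y [Sy|->]].
- apply/lsubspaceP; split.
    by exists 0; last by exists 0; rewrite ?scale0r ?addr0.
  move=> a _ _ [s Ss [b _ <-]] [t St [c _ <-]].
  exists (a *: s + t); first exact: SD.
  by exists (a * b + c); rewrite // scalerDr scalerDl scalerA addrACA.
- by exists y; [exact: sub_gen_smallest|exists 0; rewrite // scale0r addr0].
- by exists 0 => //; exists 1; rewrite // scale1r add0r.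
Qed.

End Span.

(** * Fields depending on theta alone *)

Lemma is_diff_coordf {R : realType} n (i : 'I_n) (q : 'rV[R]_n) :
  is_diff q (coordf id i) (coordf id i).
Proof.
have lin_i : linear (coordf id i : 'rV[R]_n -> R).
  by move=> c u v; rewrite /coordf !mxE.
pose ci : {linear 'rV[R]_n -> R} :=
  HB.pack (coordf id i) (GRing.isLinear.Build _ _ _ _ _ lin_i).
have cont_i : continuous ci by exact: coord_continuous.
rewrite (_ : coordf id i = ci) //.
by apply: DiffDef; [exact: linear_differentiable|rewrite diff_lin].
Qed.

Section RollingDiscSymbol.
Context {R : realType}.
Notation vec := 'rV[R]_3.
Notation vfield := (vec -> vec).
Implicit Types (X Y : vfield) (k : int).

Lemma ord3_cases (i : 'I_3) : [\/ i = 0, i = 1 | i = 2%:R].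
Proof.
case: i => [[|[|[|]]]] // ?; [constructor 1|constructor 2|constructor 3];
  exact/val_inj.
Qed.

(** The coefficients [u], [v], [a], [b] are scalars for a function and vectors
    for a vector field. The affine term covers the nilpotent fields as well as
    the constants that arise from the derivatives of the identity chart. *)
Definition trig_affine {W : lmodType R} (u v a b : W) : vec -> W :=
  fun q => cos (theta q) *: u + sin (theta q) *: v + a + theta q *: b.

Lemma is_diff_trig_affine {W : normedModType R} (u v a b : W) (q : vec) :
  is_diff q (trig_affine u v a b)
    (fun h => theta h *: trig_affine v (- u) b 0 q).
Proof.
have ? : is_diff q (@theta R) (@theta R) := is_diff_coordf 0 q.
have dc : is_diff (theta q) (@cos R) ( *:%R ^~ (- sin (theta q))).
  apply: DiffDef; first exact/derivable1_diffP/ex_derive.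
  by rewrite deriv1E ?derive1E ?derive_val //; exact: ex_derive.
have ds : is_diff (theta q) (@sin R) ( *:%R ^~ (cos (theta q))).
  apply: DiffDef; first exact/derivable1_diffP/ex_derive.
  by rewrite deriv1E ?derive1E ?derive_val //; exact: ex_derive.
have -> : trig_affine u v a b =
  (( *:%R ^~ u) \o (@cos R \o @theta R))
  + (( *:%R ^~ v) \o (@sin R \o @theta R))
  + cst a + (( *:%R ^~ b) \o @theta R) by [].
apply: is_diff_eq.
apply/funext => h; rewrite /trig_affine !fctE /= addr0 scaler0 addr0.
by rewrite !scalerN !scalerDr !scalerN !scalerA scaleNr [X in X + _]addrC.
Qed.

Lemma trig_affine0 {W : lmodType R} : trig_affine (W := W) 0 0 0 0 = 0.
Proof. by apply/funext => q; rewrite /trig_affine !scaler0 !addr0. Qed.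

Lemma derive_trig_affine {W : normedModType R} (u v a b : W) (q h : vec) :
  'D_h (trig_affine u v a b) q = theta h *: trig_affine v (- u) b 0 q.
Proof.
have dF := is_diff_trig_affine u v a b q.
by rewrite deriveE ?diff_val //; exact: ex_diff.
Qed.

Lemma pder_trig_affine {W : normedModType R} (i : 'I_3) (u v a b : W) :
  pder i (trig_affine u v a b) = if i == 0 then trig_affine v (- u) b 0 else 0.
Proof.
apply/funext => q; rewrite /pder derive_trig_affine /theta mxE eqxx /= eq_sym.
by case: eqP; rewrite ?scale1r ?scale0r.
Qed.

Lemma foldr_pder_trig_affine {W : normedModType R} (u v a b : W)
    (s : seq 'I_3) :
  exists u' v' a' b',
    foldr pder (trig_affine u v a b) s = trig_affine u' v' a' b'.
Proof.
elim: s => [|i s [u' [v' [a' [b' /= ->]]]]]; first by exists u, v, a, b.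
rewrite pder_trig_affine; case: ifP => _; first by exists v', (- u'), b', 0.
by exists 0, 0, 0, 0; rewrite trig_affine0.
Qed.

Lemma smooth_trig_affine {W : normedModType R} (u v a b : W) (p : vec) :
  smooth_near p (trig_affine u v a b).
Proof.
rewrite /smooth_near; near=> q => s.
have [u' [v' [a' [b' ->]]]] := foldr_pder_trig_affine u v a b s.
exact: (@ex_diff _ _ _ _ _ _ _ (is_diff_trig_affine _ _ _ _ _)).
Unshelve. all: by end_near. Qed.

Lemma pder_id (i : 'I_3) : pder i (@id vec) = trig_affine 0 0 (delta_mx 0 i) 0.
Proof.
apply/funext => q; rewrite /pder derive_id /trig_affine.
by rewrite !scaler0 !addr0 add0r.
Qed.

(** The identity chart itself is not a function of [theta], but its first
    derivatives are constant, which brings all later ones under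
    [foldr_pder_trig_affine]. *)
Lemma smooth_id (p : vec) : smooth_near p (@id vec).
Proof.
rewrite /smooth_near; near=> q => s; have [->|[u [v [a [b ->]]]]] :
    foldr pder (@id vec) s = id \/
    exists u v a b, foldr pder (@id vec) s = trig_affine u v a b.
- elim: s => [|i s [/= ->|[u [v [a [b /= ->]]]]]]; first by left.
    by right; rewrite pder_id; exists 0, 0, (delta_mx 0 i), 0.
  by right; exact: (foldr_pder_trig_affine u v a b [:: i]).
- exact: ex_diff.
exact: (@ex_diff _ _ _ _ _ _ _ (is_diff_trig_affine _ _ _ _ _)).
Unshelve. all: by end_near. Qed.

Lemma in_coords_id (X : vec -> vec) : in_coords id id X = X.
Proof. by apply/funext => v; rewrite /in_coords diff_val. Qed.

Lemma coordf_trig_affine (u v a b : vec) (i : 'I_3) :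
  coordf (trig_affine u v a b) i =
  trig_affine (W := R) (u 0 i) (v 0 i) (a 0 i) (b 0 i).
Proof. by apply/funext => q; rewrite /coordf /trig_affine !mxE. Qed.

(** * The rolling disc at the origin *)

Lemma disc1E : disc1 (R := R) = trig_affine 0 0 (d_theta R) 0.
Proof.
by apply/funext => q; rewrite /trig_affine !scaler0 !addr0 add0r.
Qed.

Lemma disc2E : disc2 (R := R) = trig_affine (d_x R) (d_y R) 0 0.
Proof. by apply/funext => q; rewrite /trig_affine scaler0 !addr0. Qed.

Lemma ord2_cases (i : 'I_2) : i = 0 \/ i = 1.
Proof. by case: i => [[|[|]]] // ?; [left|right]; apply/val_inj. Qed.

Lemma disc_ord0 : disc R 0 = disc1 (R := R). Proof. by []. Qed.

Lemma disc_ord1 : disc R 1 = disc2 (R := R). Proof. by []. Qed.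

Lemma disc_vfield i : vfield_S1xR2 (disc R i).
Proof.
split=> [p|q].
  by case: (ord2_cases i) => ->; rewrite (disc_ord0, disc_ord1) (disc1E, disc2E);
    exact: smooth_trig_affine.
case: (ord2_cases i) => ->; rewrite ?disc_ord0 ?disc_ord1 // /disc2.
have -> : theta (q + 2 * pi *: d_theta R) = theta q + pi *+ 2.
  by rewrite /theta !mxE /= mulr1 mulr_natl.
by rewrite cosD2pi sinD2pi.
Qed.

Lemma theta0 : theta (0 : vec) = 0. Proof. by rewrite /theta mxE. Qed.

Lemma row3_decomp (v : vec) :
  v = v 0 0 *: d_theta R + v 0 1 *: d_x R + v 0 2%:R *: d_y R.
Proof.
apply/rowP => i; rewrite !mxE.
by case: (ord3_cases i) => -> /=; rewrite ?mulr1 ?mulr0 ?addr0 ?add0r.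
Qed.

Lemma trig_affine_at0 {W : lmodType R} (u v a b : W) :
  trig_affine u v a b (0 : vec) = u + a.
Proof. by rewrite /trig_affine theta0 cos0 sin0 scale1r !scale0r !addr0. Qed.

Lemma bracket_trig_affine (u v a b u' v' a' b' : vec) q :
  bracket (trig_affine u v a b) (trig_affine u' v' a' b') q =
  theta (trig_affine u v a b q) *: trig_affine v' (- u') b' 0 q -
  theta (trig_affine u' v' a' b' q) *: trig_affine v (- u) b 0 q.
Proof. by rewrite /bracket !derive_trig_affine. Qed.

Lemma theta_basis :
  (theta (d_theta R) = 1) * (theta (d_x R) = 0) * (theta (d_y R) = 0).
Proof. by rewrite /theta /d_theta /d_x /d_y !mxE. Qed.

(** As [disc1] is constant, only the derivative of [disc2] along [d_theta]
    survives. It is the direction missing from the distribution at the origin. *)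
Lemma bracket_disc12_0 : bracket (disc1 (R := R)) (disc2 (R := R)) 0 = d_y R.
Proof.
rewrite disc1E disc2E bracket_trig_affine !trig_affine_at0 add0r !addr0.
by rewrite !theta_basis scale1r scale0r subr0.
Qed.

Lemma bracketxx (X : vec -> vec) : bracket X X = 0.
Proof. by apply/funext => q; rewrite /bracket subrr. Qed.

Lemma enum_ord2 : enum 'I_2 = [:: 0; 1].
Proof. by rewrite !enum_ordSl enum_ord0 /=; congr [:: _; _]; apply/val_inj. Qed.

Lemma disc1_0 : disc1 (R := R) 0 = d_theta R. Proof. by []. Qed.

Lemma disc2_0 : disc2 (R := R) 0 = d_x R.
Proof. by rewrite disc2E trig_affine_at0 addr0. Qed.

Lemma flag1 : flag (disc R) 0 1 = <<[:: d_theta R; d_x R]>>%VS.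
Proof.
rewrite /flag /= /codom /image_mem enum_ord2 /= disc_ord0 disc_ord1.
by rewrite disc1_0 disc2_0.
Qed.

Lemma flag2 : flag (disc R) 0 2 = fullv.
Proof.
apply/vspaceP => v; rewrite memvf.
have in_flag w : w \in [:: d_theta R; d_x R; d_y R] -> w \in flag (disc R) 0 2.
  move=> wI; apply: memv_span; move: wI.
  rewrite /= /codom /image_mem enum_ord2 /= disc_ord0 disc_ord1 disc1_0 disc2_0.
  rewrite bracket_disc12_0.
  by rewrite !inE => /or3P[] ->; rewrite ?orbT.
by rewrite (row3_decomp v) !memvD ?memvZ ?in_flag ?inE ?eqxx ?orbT.
Qed.

Lemma disc_growth_vector : growth_vector (disc R) 0 [:: 2; 3]%N.
Proof.
split=> // [[|[|//]] _|]; last exact: flag2.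
- rewrite flag1; apply/eqP.
  (* a sequence is free when the dimension of its span is its length *)
  change (free [:: d_theta R; d_x R]).
  rewrite free_cons seq1_free span_seq1; apply/andP; split.
    apply/vlineP => -[k /rowP/(_ 0)]; rewrite !mxE /= mulr0.
    by move/eqP; rewrite oner_eq0.
  by apply/eqP => /rowP/(_ 1); rewrite !mxE /= => /eqP; rewrite oner_eq0.
- by rewrite flag2 dimvf /dim /=.
Qed.

Lemma lieD_coordf (X : vec -> vec) i : lieD X (coordf id i) = coordf X i.
Proof.
apply/funext => q; have ? := is_diff_coordf i q.
by rewrite /lieD deriveE ?diff_val //; exact: ex_diff.
Qed.

Lemma disc_nonholonomic_order i :
  nonholonomic_order (disc R) 0 (coordf id i) (wt i).
Proof.
have order0 : coordf id i (0 : vec) = 0 by rewrite /coordf mxE.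
case: (ord3_cases i) => E; rewrite E in order0 *; split.
- exists [:: 0] => //=.
  by rewrite lieD_coordf disc_ord0 /coordf disc1_0 mxE /= oner_eq0.
- by case.
- exists [:: 1] => //=.
  by rewrite lieD_coordf disc_ord1 /coordf disc2_0 mxE /= oner_eq0.
- by case.
- (* X_1 (X_2 y), the derivative of sin theta along d_theta *)
  exists [:: 0; 1] => //=; rewrite lieD_coordf disc_ord0 disc_ord1 /lieD disc2E.
  rewrite coordf_trig_affine derive_trig_affine disc1_0 trig_affine_at0 theta_basis.
  by rewrite scale1r !mxE /= addr0 oner_eq0.
- case=> [|k [|//]] // _; rewrite /= lieD_coordf.
  by case: (ord2_cases k) => ->;
    rewrite ?disc_ord0 ?disc_ord1 /coordf ?disc1_0 ?disc2_0 mxE.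
Qed.

Lemma disc_privileged : privileged (disc R) 0 id id.
Proof.
split; first split => //; do ?exact: smooth_id.
- by split; near=> q.
- exact: disc_nonholonomic_order.
move=> a b ab0.
have dE i : 'd (coordf id i) (0 : vec) = coordf id i :> (vec -> R).
  by have ? := is_diff_coordf i (0 : vec); rewrite diff_val.
split.
  have := ab0 (d_theta R); rewrite !dE /coordf !mxE /= mulr1 mulr0 addr0; apply.
  by rewrite flag1 memv_span ?inE ?eqxx.
have := ab0 (d_x R); rewrite !dE /coordf !mxE /= mulr1 mulr0 add0r; apply.
by rewrite flag1 memv_span ?inE ?eqxx ?orbT.
Unshelve. all: by end_near. Qed.

(** * Weighted parts *)

Lemma iter_pder_trig_affine_neq0 (i : 'I_3) (j : nat) (u v a b : R) : i != 0 ->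
  iter j (pder i) (trig_affine u v a b) =
  if j is 0%N then trig_affine u v a b else 0.
Proof.
move=> /negPf i0; case: j => // j; rewrite iterSr pder_trig_affine i0.
by elim: j => //= j ->; rewrite -trig_affine0 pder_trig_affine i0 trig_affine0.
Qed.

Lemma iter_pder_0 (i : 'I_3) (j : nat) : iter j (pder i) 0 = 0 :> (vec -> R).
Proof.
elim: j => //= j ->; rewrite -trig_affine0 pder_trig_affine oppr0.
by case: ifP => //; rewrite trig_affine0.
Qed.

Lemma enum_ord3 : enum 'I_3 = [:: 0; 1; 2%:R].
Proof. by rewrite !enum_ordSl enum_ord0 /=; congr [:: _; _; _]; apply/val_inj. Qed.

(** A multi-index with a positive entry in [x] or [y] contributes a vanishing
    derivative, and the only other one of weighted degree [d] is [(d, 0, 0)]. *)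
Lemma weighted_part_trig_affine d (u v a b : R) (q : vec) :
  weighted_part wt d (trig_affine u v a b) q =
  iter d (pder 0) (trig_affine u v a b) 0 / d`!%:R * theta q ^+ d.
Proof.
pose al0 : {ffun 'I_3 -> 'I_d.+1} := [ffun i => if i == 0 then ord_max else ord0].
have sum3 (F : 'I_3 -> nat) : (\sum_i F i = F 0%R + F 1%R + F 2%:R%R)%N.
  rewrite !big_ord_recl big_ord0 addn0 addnA.
  by congr (F _ + F _ + F _)%N; apply/val_inj.
rewrite /weighted_part (bigD1 al0) /=; last first.
  by rewrite sum3 !ffunE /= !muln0 !addn0 mul1n.
rewrite [X in _ + X]big1 => [|al /andP[/eqP aldeg al_neq]].
  rewrite addr0; congr (_ / _ * _).
  - by rewrite /mder enum_ord3 /= !ffunE /=.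
  - by rewrite !big_ord_recl big_ord0 !ffunE /= !muln1.
  - by rewrite !big_ord_recl big_ord0 !ffunE /= !expr0 !mulr1.
suff -> : mder (fun i => al i) (trig_affine u v a b) 0 = 0 by rewrite !mul0r.
rewrite /mder enum_ord3 /= (@iter_pder_trig_affine_neq0 2%:R) //.
case al2 : (nat_of_ord (al 2%:R)) => [|k2]; last by rewrite !iter_pder_0.
rewrite (@iter_pder_trig_affine_neq0 1) //.
case al1 : (nat_of_ord (al 1)) => [|k1]; last by rewrite !iter_pder_0.
case/eqP: al_neq; apply/ffunP => i; apply/val_inj; rewrite ffunE.
move: aldeg; rewrite sum3 al1 al2 !muln0 !addn0 mul1n => al00.
by case: (ord3_cases i) => -> /=.
Qed.

(** * The Heisenberg algebra *)

Definition heis (a b c : R) : vfield := a *: n1 R + b *: n2 R + c *: n3 R.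

Lemma heisE a b c :
  heis a b c =
  trig_affine 0 0 (a *: d_theta R + b *: d_x R + c *: d_y R) (b *: d_y R).
Proof.
apply/funext => q; rewrite /trig_affine !scaler0 !add0r /heis.
apply/rowP => i; rewrite !mxE; ring.
Qed.

Lemma heis_at0 a b c : heis a b c 0 = a *: d_theta R + b *: d_x R + c *: d_y R.
Proof. by rewrite heisE trig_affine_at0 add0r. Qed.

Lemma heis_inj a b c a' b' c' :
  heis a b c = heis a' b' c' -> [/\ a = a', b = b' & c = c'].
Proof.
move/(congr1 (fun X : vfield => X 0)); rewrite !heis_at0 => /rowP E.
move: (E 0) (E 1) (E 2%:R); rewrite !mxE /= !mulr0 !mulr1 !addr0 !add0r.
by [].
Qed.

Lemma heis0 : heis 0 0 0 = 0.
Proof. by rewrite /heis !scale0r !addr0. Qed.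

Lemma heisZD (x : R) a b c a' b' c' :
  x *: heis a b c + heis a' b' c' = heis (x * a + a') (x * b + b') (x * c + c').
Proof.
by rewrite /heis; apply/funext => q; apply/rowP => i; rewrite !mxE; ring.
Qed.

Lemma bracket_heis a b c a' b' c' :
  bracket (heis a b c) (heis a' b' c') = heis 0 0 (a * b' - a' * b).
Proof.
apply/funext => q; rewrite !heisE bracket_trig_affine /trig_affine /theta !oppr0.
apply/rowP => i; rewrite !mxE /=; ring.
Qed.

Lemma heis_n1 : heis 1 0 0 = n1 R.
Proof. by rewrite /heis scale1r !scale0r !addr0. Qed.
Lemma heis_n2 : heis 0 1 0 = n2 R.
Proof. by rewrite /heis scale1r !scale0r addr0 add0r. Qed.
Lemma heis_n3 : heis 0 0 1 = n3 R.
Proof. by rewrite /heis scale1r !scale0r !add0r. Qed.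

Lemma lspan_n12 : lspan [set n1 R; n2 R] = [set Y | exists a b, Y = heis a b 0].
Proof.
rewrite lspan_setU1 lspan_set1; apply/seteqP; split=> Y /=.
  by move=> [_ [a _ <-] [b _ <-]]; exists a, b; rewrite /heis scale0r addr0.
move=> [a [b ->]]; exists (a *: n1 R); first by exists a.
by exists b; rewrite // /heis scale0r addr0.
Qed.

Lemma lspan_n3 : lspan [set n3 R] = [set Y | exists c, Y = heis 0 0 c].
Proof.
rewrite lspan_set1; apply/seteqP; split=> Y /=.
  by move=> [c _ <-]; exists c; rewrite /heis !scale0r !add0r.
by move=> [c ->]; exists c; rewrite // /heis !scale0r !add0r.
Qed.

Lemma lspan_n123 :
  lspan [set n1 R; n2 R; n3 R] = [set Y | exists a b c, Y = heis a b c].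
Proof.
rewrite lspan_setU1 lspan_n12; apply/seteqP; split=> Y /=.
  by move=> [_ [a [b ->]] [c _ <-]]; exists a, b, c; rewrite /heis scale0r addr0.
move=> [a [b [c ->]]]; exists (heis a b 0); first by exists a, b.
by exists c; rewrite // /heis scale0r addr0.
Qed.

Lemma weighted_part_affine d (a b : R) (q : vec) :
  weighted_part wt d (trig_affine 0 0 a b) q =
  a *+ (d == 0%N) + theta q * b *+ (d == 1%N).
Proof.
rewrite weighted_part_trig_affine; case: d => [|[|d]].
- by rewrite /= trig_affine_at0 add0r divr1 mulr1 mulr0n addr0.
- rewrite /= pder_trig_affine eqxx trig_affine_at0 ?oppr0 add0r divr1.
  by rewrite mulr0n add0r mulr1n mulrC.
- have -> : iter d.+2 (pder 0) (trig_affine 0 0 a b : vec -> R) 0 = 0.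
    by rewrite !iterSr !pder_trig_affine /= oppr0 trig_affine0 iter_pder_0.
  by rewrite !mul0r !mulr0n addr0.
Qed.

(** This is the coefficient of a coordinate of weight [w] in the part of degree
    [k] of a field: the constant term has weighted degree [- w] and the term
    linear in [theta] has degree [1 - w]. *)
Lemma weighted_part_shift (w : nat) k (a b : R) (q : vec) :
  (if w%:Z + k is Posz d then weighted_part wt d (trig_affine 0 0 a b) q
   else 0) =
  a *+ (k == - w%:Z) + theta q * b *+ (k == 1 - w%:Z).
Proof.
case E : (w%:Z + k) => [d|d].
  rewrite weighted_part_affine.
  by congr (_ *+ nat_of_bool _ + _ *+ nat_of_bool _); lia.
have -> : (k == - w%:Z) = false by lia.
have -> : (k == 1 - w%:Z) = false by lia.
by rewrite addr0.
Qed.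

(** The field [heis a b c] has the constant coefficients [a] and [b] along
    coordinates of weight 1, and the coefficient [c + b theta] along the
    coordinate of weight 2, so the two terms in [b] both have degree -1. *)
Lemma vfield_part_heis k a b c :
  vfield_part wt k (heis a b c) =
  heis (a *+ (k == - 1)) (b *+ (k == - 1)) (c *+ (k == - 2)).
Proof.
apply/funext => q; rewrite /vfield_part [in RHS]heisE.
apply/rowP => i; rewrite [LHS]mxE heisE coordf_trig_affine.
rewrite [X in trig_affine X]mxE [X in trig_affine _ X]mxE.
rewrite weighted_part_shift; case: (ord3_cases i) => -> /=.
all: rewrite ?mxE /= ?scaler0 ?scale0r ?mulr0 ?mulr1 ?addr0 ?add0r ?mul0rn ?addr0.
- by [].
- by [].
- by rewrite mulrnAr.
Qed.

Lemma nilpotent_approx_disc1 : nilpotent_approx id id (disc R) 0 = n1 R.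
Proof.
rewrite /nilpotent_approx in_coords_id -heis_n1 -[disc R 0]heis_n1.
by rewrite vfield_part_heis /= mulr1n !mul0rn.
Qed.

(** The Taylor terms kept are [cos 0 = 1] and [sin 0 = 0] in the coefficients of
    weight 1, and [cos 0 theta = theta] in the coefficient of weight 2. *)
Lemma nilpotent_approx_disc2 : nilpotent_approx id id (disc R) 1 = n2 R.
Proof.
rewrite /nilpotent_approx in_coords_id disc_ord1 disc2E.
apply/funext => q; apply/rowP => i; rewrite [LHS]mxE coordf_trig_affine.
case: (ord3_cases i) => ->; rewrite /wt /= weighted_part_trig_affine /=.
all: rewrite ?pder_trig_affine ?eqxx trig_affine_at0.
all: rewrite !mxE /= ?divr1 ?mulr1 ?mulr0 ?mul0r ?addr0 ?add0r.
- by [].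
- by [].
- by rewrite mul1r expr1.
Qed.

Lemma heis_lie_closed : lie_closed bracket [set Y | exists a b c, Y = heis a b c].
Proof.
split; first by rewrite -lspan_n123; exact: lspan_lsubspace.
move=> _ _ [a [b [c ->]]] [a' [b' [c' ->]]].
by rewrite bracket_heis; exists 0, 0, (a * b' - a' * b).
Qed.

Lemma symbolE : symbol id id (disc R) = [set Y | exists a b c, Y = heis a b c].
Proof.
apply/seteqP; split.
  apply: smallest_sub => [|_ [i _ <-]]; first exact: heis_lie_closed.
  case: (ord2_cases i) => ->.
    by rewrite nilpotent_approx_disc1; exists 1, 0, 0; rewrite heis_n1.
  by rewrite nilpotent_approx_disc2; exists 0, 1, 0; rewrite heis_n2.
move=> _ [a [b [c ->]]] M [[M_sub M_br] n12M].
have M1 : M (n1 R) by apply: n12M; exists 0; rewrite // nilpotent_approx_disc1.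
have M2 : M (n2 R) by apply: n12M; exists 1; rewrite // nilpotent_approx_disc2.
have M3 : M (n3 R).
  rewrite -heis_n3 (_ : heis 0 0 1 = bracket (n1 R) (n2 R)); first exact: M_br.
  by rewrite -heis_n1 -heis_n2 bracket_heis mulr1 mulr0 subr0.
by do !apply: (lsubspaceD M_sub); apply: (lsubspaceZ _ M_sub).
Qed.

(** Taking weighted parts is idempotent on Heisenberg fields, so the fixed points
    of the part of degree [k] are exactly its values. *)
Lemma symbol_gradeE k :
  symbol_grade id id (disc R) k =
  [set Y | exists a b c,
    Y = heis (a *+ (k == - 1)) (b *+ (k == - 1)) (c *+ (k == - 2))].
Proof.
rewrite /symbol_grade symbolE; apply/seteqP; split=> Y /=.
  by move=> [[a [b [c ->]]] ->]; exists a, b, c; rewrite vfield_part_heis.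
move=> [a [b [c ->]]]; split.
  by exists (a *+ (k == - 1)), (b *+ (k == - 1)), (c *+ (k == - 2)).
by rewrite vfield_part_heis; case: (k == -1); case: (k == -2).
Qed.

Lemma symbol_gradeN1 :
  symbol_grade id id (disc R) (- 1) = lspan [set n1 R; n2 R].
Proof.
rewrite symbol_gradeE lspan_n12 eqxx /=; apply/seteqP; split=> Y /=.
  by move=> [a [b [c ->]]]; exists a, b.
by move=> [a [b ->]]; exists a, b, 0.
Qed.

Lemma symbol_gradeN2 : symbol_grade id id (disc R) (- 2) = lspan [set n3 R].
Proof.
rewrite symbol_gradeE lspan_n3 eqxx /=; apply/seteqP; split=> Y /=.
  by move=> [a [b [c ->]]]; exists c.
by move=> [c ->]; exists 0, 0, c.
Qed.

Lemma symbol_grade_neq k Y : k != - 1 -> k != - 2 ->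
  symbol_grade id id (disc R) k Y -> Y = 0.
Proof.
rewrite symbol_gradeE => /negPf -> /negPf -> [a [b [c ->]]].
by rewrite !mulr0n heis0.
Qed.

(** A family of homogeneous elements lives in the degrees -2 and -1, which
    reduces the sum over all of [int] to two terms, both for the existence and
    for the uniqueness of the decomposition. *)
Lemma symbol_sum (y : int -> vfield) :
  (forall k, symbol_grade id id (disc R) k (y k)) ->
  finite_set [set k | y k != 0] /\
  \sum_(k \in [set: int]) y k = y (- 2) + y (- 1).
Proof.
move=> gy.
have supp k : ~ [set - 2 ; - 1] k -> y k = 0.
  move=> k12; apply: symbol_grade_neq (gy k); apply/eqP => kE; apply: k12.
    by right.
  by left.
split.
  apply: (sub_finite_set (B := [set - 2; - 1])) => [k yk|//].
  by apply: contrapT => /supp yk0; rewrite /= yk0 eqxx in yk.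
rewrite -(@fsbig_widen _ _ _ _ [set - 2; - 1]) //; last first.
  by move=> k [_ /supp].
rewrite fsbigU0 ?fsbig_set1 //.
by move=> k [/= -> ].
Qed.

Lemma symbol_lie_grading :
  lie_grading bracket (symbol id id (disc R)) (symbol_grade id id (disc R)).
Proof.
split.
- move=> k; apply/lsubspaceP; rewrite symbol_gradeE; split.
    by exists 0, 0, 0; rewrite !mul0rn heis0.
  move=> x _ _ [a [b [c ->]]] [a' [b' [c' ->]]].
  exists (x * a + a'), (x * b + b'), (x * c + c').
  by rewrite heisZD !mulrnDl !mulrnAr.
- by move=> k Y [].
- move=> x mx; exists (fun k => vfield_part wt k x).
  move: mx; rewrite symbolE => -[a [b [c ->]]].
  have gpart k : symbol_grade id id (disc R) k (vfield_part wt k (heis a b c)).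
    by rewrite symbol_gradeE vfield_part_heis; exists a, b, c.
  split.
    have [fin sum_eq] := symbol_sum gpart; split=> //.
    rewrite sum_eq !vfield_part_heis /= -[X in _ = X + _]scale1r heisZD.
    by rewrite !mulr0n !mulr1n !mulr0 !mul1r !add0r addr0.
  move=> y [gy _]; have [_ ->] := symbol_sum gy.
  move: (gy (- 2)) (gy (- 1)); rewrite !symbol_gradeE !eqxx.
  move=> [? [? [c' y2]]] [a' [b' [? y1]]] /[dup] xE.
  rewrite y1 y2 /= !mulr0n !mulr1n -[X in X + _]scale1r heisZD.
  rewrite mulr0 !add0r mul1r addr0.
  move=> /heis_inj[-> -> ->]; apply/funext => k; rewrite vfield_part_heis.
  have [->|kN1] := eqVneq k (- 1); first by rewrite y1.
  have [->|kN2] := eqVneq k (- 2); first by rewrite y2.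
  by rewrite !mulr0n heis0 (symbol_grade_neq kN1 kN2 (gy k)).
- move=> j k X Y; rewrite !symbol_gradeE => -[a [b [c ->]]] [a' [b' [c' ->]]].
  rewrite bracket_heis.
  (* the bracket vanishes unless both factors have degree -1 *)
  have [->|jN1] := eqVneq j (- 1); have [->|kN1] := eqVneq k (- 1).
  - by exists 0, 0, (a * b' - a' * b); rewrite !mul0rn !mulr1n.
  all: by exists 0, 0, 0; rewrite ?mulr0n !mul0rn ?mulr0 ?mul0r subr0.
Qed.

Lemma symbol_lie_algebra : lie_algebra bracket (symbol id id (disc R)).
Proof.
rewrite symbolE; split; first exact: heis_lie_closed.
- move=> x _ _ _ [a [b [c ->]]] [a' [b' [c' ->]]] [a'' [b'' [c'' ->]]].
  rewrite heisZD !bracket_heis heisZD; congr heis; ring.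
- move=> x _ _ _ [a [b [c ->]]] [a' [b' [c' ->]]] [a'' [b'' [c'' ->]]].
  rewrite heisZD !bracket_heis heisZD; congr heis; ring.
- by move=> X _; exact: bracketxx.
- move=> _ _ _ [a [b [c ->]]] [a' [b' [c' ->]]] [a'' [b'' [c'' ->]]].
  by rewrite !bracket_heis !mulr0 !mul0r !subr0 heis0 !addr0.
Qed.

(** Brackets lie in the line of [n3], and [n3] is central. *)
Lemma symbol_lie_nilpotent : lie_nilpotent bracket (symbol id id (disc R)).
Proof.
exists 2%N; apply/seteqP; split; last first.
  by move=> _ ->; have /lsubspaceP[] := @lspan_lsubspace R vfield
    [set bracket x y | x in symbol id id (disc R)
                     & y in lower_central bracket (symbol id id (disc R)) 1].
apply: smallest_sub.
  by apply/lsubspaceP; split=> // a _ _ -> ->; rewrite /= scaler0 addr0.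
have LC1 : lower_central bracket (symbol id id (disc R)) 1 `<=`
    [set Y | exists c, Y = heis 0 0 c].
  apply: smallest_sub; first by rewrite -lspan_n3; exact: lspan_lsubspace.
  rewrite symbolE => _ [_ [a [b [c ->]]] [_ [a' [b' [c' ->]]] <-]].
  by rewrite bracket_heis; eexists.
move=> _ [X mX [Y /LC1[c ->] <-]]; move: mX; rewrite symbolE => -[a [b [c' ->]]].
by rewrite bracket_heis mulr0 mul0r subr0 heis0.
Qed.

Lemma lin_indep_n123 : lin_indep [:: n1 R; n2 R; n3 R].
Proof.
move=> c /=; rewrite !big_ord_recl big_ord0 /= addr0 addrA => E.
have [c0 c1 c2] := heis_inj (etrans E (esym heis0)).
move=> i; case: (ord3_cases i) => ->;
  [rewrite -[RHS]c0|rewrite -[RHS]c1|rewrite -[RHS]c2];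
  congr c; exact/val_inj.
Qed.

Lemma symbol_direct_sum : direct_sum (symbol id id (disc R))
  (symbol_grade id id (disc R) (- 2)) (symbol_grade id id (disc R) (- 1)).
Proof.
rewrite symbol_gradeN1 symbol_gradeN2 lspan_n12 lspan_n3 symbolE.
have heisD a b c : heis a b c = heis 0 0 c + heis a b 0.
  by rewrite -[heis 0 0 c]scale1r heisZD !mulr0 mul1r !add0r addr0.
split; apply/seteqP; split=> Y /=.
- by move=> [[c ->] [a [b /heis_inj[_ _ ->]]]]; exact: heis0.
- by move=> ->; rewrite -heis0; split; [exists 0|exists 0, 0].
- move=> [a [b [c ->]]]; exists (heis 0 0 c); first by exists c.
  by exists (heis a b 0); [exists a, b|rewrite -heisD].
- by move=> [_ [c ->] [_ [a [b ->]] <-]]; exists a, b, c; rewrite -heisD.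
Qed.

End RollingDiscSymbol.

Theorem lemma3p1 (R : realType) :
  [/\ forall i, vfield_S1xR2 (disc R i),
      growth_vector (disc R) 0 [:: 2; 3]%N &
      privileged (disc R) 0 id id] /\
  (nilpotent_approx id id (disc R) 0 = n1 R /\
   nilpotent_approx id id (disc R) 1 = n2 R) /\
  [/\ bracket (n1 R) (n2 R) = n3 R, n3 R <> 0,
      bracket (n1 R) (n3 R) = 0 &
      bracket (n2 R) (n3 R) = 0] /\
  [/\ symbol id id (disc R) = lspan [set n1 R; n2 R; n3 R],
      lin_indep [:: n1 R; n2 R; n3 R],
      lie_algebra bracket (symbol id id (disc R)) &
      lie_nilpotent bracket (symbol id id (disc R))] /\
  lie_grading bracket (symbol id id (disc R)) (symbol_grade id id (disc R)) /\
  [/\ direct_sum (symbol id id (disc R)) (symbol_grade id id (disc R) (- 2))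
        (symbol_grade id id (disc R) (- 1)),
      symbol_grade id id (disc R) (- 2) = lspan [set n3 R] &
      symbol_grade id id (disc R) (- 1) = lspan [set n1 R; n2 R]].
Proof.
split.
  by split; [exact: disc_vfield|exact: disc_growth_vector|exact: disc_privileged].
split.
  by split; [exact: nilpotent_approx_disc1|exact: nilpotent_approx_disc2].
split.
  rewrite -heis_n1 -heis_n2 -heis_n3 !bracket_heis !(mulr0, mul0r) !subr0 mulr1 heis0.
  split=> //; rewrite -heis0 => /heis_inj[_ _ /eqP]; by rewrite oner_eq0.
split; first split.
- by rewrite symbolE lspan_n123.
- exact: lin_indep_n123.
- exact: symbol_lie_algebra.
- exact: symbol_lie_nilpotent.
split; first exact: symbol_lie_grading.
by split; [exact: symbol_direct_sum|exact: symbol_gradeN2|exact: symbol_gradeN1].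
Qed.
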